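(* Let $H$ be a Hilbert holomorphic function space on the open unit disk $\mathbb{D}$. Then $H$ admits a linear polynomial approximation scheme if and only if $H$ contains a dense subspace of polynomials (i.e. the set of polynomials belonging to $H$ is norm-dense in $H$).
   Context: $\mathbb{D}$ denotes the open unit disk in $\mathbb{C}$, and $\mathrm{Hol}(\mathbb{D})$ the Fréchet space of holomorphic functions on $\mathbb{D}$ with the topology of uniform convergence on compact sets. A Hilbert holomorphic function space on $\mathbb{D}$ is a (complex) Hilbert space $H$ that is a subset (linear subspace) of $\mathrm{Hol}(\mathbb{D})$ such that the inclusion map $H\hookrightarrow\mathrm{Hol}(\mathbb{D})$ is continuous. It is not assumed that $H$ contains all polynomials. A linear polynomial approximation scheme for $H$ is a sequence of continuous linear operators $T_n:H\to H$ such that, for each $f\in H$, the functions $T_n(f)$ are polynomials and $\|T_n(f)-f\|_H\to0$ as $n\to\infty$. *)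

(* Defs.v *)
From HB Require Import structures.
From mathcomp Require Import all_boot all_order all_algebra sesquilinear.
From mathcomp Require Import all_classical all_reals all_analysis.
From mathcomp Require Import complex.

Set Implicit Arguments.
Unset Strict Implicit.
Unset Printing Implicit Defensive.

Import Order.TTheory GRing.Theory Num.Theory.
Import numFieldNormedType.Exports.

Local Open Scope classical_set_scope.
Local Open Scope ring_scope.

(* [R[i]] is also canonically an [R]-module; going through this constant makes
   sure that it is always seen as a normed space over itself. *)
Definition cplx (R : realType) : numClosedFieldType := R[i].

(* Hilbert spaces. The inner product is linear in its first argument and
   conjugate-linear in the second one. *)
HB.mixin Record CompleteNormedModule_isHilbert (K : numClosedFieldType) H
    & CompleteNormedModule K H := {
  inner : {dot H for (@Num.conj K)} ;
  sqr_normE : forall x : H, `|x| ^+ 2 = inner x x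
}.

#[short(type="hilbertType")]
HB.structure Definition Hilbert (K : numClosedFieldType) :=
  {H of CompleteNormedModule K H & CompleteNormedModule_isHilbert K H}.

Section Holomorphic.
Variable R : realType.
Local Notation C := (cplx R).

Definition disk : set C := [set z | `|z| < 1].

(* Since the disk is open, the extension by 0 plays no role in the existence of
   the complex derivative at a point of the disk. *)
Definition extend0 (f : disk -> C) : C -> C :=
  fun z => if insub z is Some w then f w else 0.

Definition holomorphic : {pred disk -> C} :=
  fun f => `[< forall z : disk, derivable (extend0 f) (val z) 1 >].

Lemma holomorphic_submod_closed : submod_closed holomorphic.
Proof.
split.
  apply/asboolP => z.
  suff -> : extend0 0 = cst 0 by exact: derivable_cst.
  by apply/funext => w; rewrite /extend0; case: insubP.
move=> a f g /asboolP hf /asboolP hg; apply/asboolP => z.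
suff -> : extend0 (a *: f + g) = a *: extend0 f + extend0 g.
  by apply: derivableD => //; exact: derivableZ.
apply/funext => w; rewrite /extend0 !fctE; case: insubP => //= _.
by rewrite scaler0 addr0.
Qed.

HB.instance Definition _ :=
  GRing.isSubmodClosed.Build C (disk -> C) holomorphic holomorphic_submod_closed.

Record Hol := MkHol { hol_val :> disk -> C ; _ : hol_val \in holomorphic }.

HB.instance Definition _ := [isSub for hol_val].
HB.instance Definition _ := [Choice of Hol by <:].
HB.instance Definition _ := [SubChoice_isSubLmodule of Hol by <:].

HB.instance Definition _ := Topological.copy Hol
  (initial_topology (hol_val : Hol -> {family compact, disk -> C})).

Definition is_polynomial (f : Hol) : Prop :=
  exists p : {poly C}, forall z : disk, f z = p.[val z].

(* A Hilbert holomorphic function space on the disk is given by a Hilbert space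
   [H] together with its inclusion map [incl] into [Hol]. *)
Definition hilbert_holomorphic_space (H : hilbertType C)
    (incl : {linear H -> Hol}) : Prop :=
  injective incl /\ continuous incl.

Definition linear_polynomial_approximation_scheme (H : hilbertType C)
    (incl : {linear H -> Hol}) (T : nat -> {linear H -> H}) : Prop :=
  (forall n, continuous (T n)) /\
  (forall f : H, (forall n, is_polynomial (incl (T n f))) /\
     `|T n f - f| @[n --> \oo] --> (0 : C)).

Definition polynomials_in (H : hilbertType C) (incl : {linear H -> Hol}) :
  set H := [set f | is_polynomial (incl f)].

End Holomorphic.

(* Main.v *)
Require Import Defs.
From mathcomp Require Import all_boot all_order all_algebra.
From mathcomp Require Import all_classical all_reals all_analysis.
From HB Require Import structures.
From mathcomp Require Import sesquilinear.

(** A scheme approximates each [f] by the polynomials [T n f] of [H], so only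
    the existence of a scheme needs an argument.  Filter the polynomials
    lying in [H] by degree: let [V n] be the set of elements of [H] that are
    polynomials of degree less than [n].  Each [V n.+1] is spanned by [V n] and
    at most one further vector, since the leading coefficient of any fixed
    element of [V n.+1] outside [V n] can be used to cancel that of any other
    ([degree_filtrationS]).  As the inclusion map is injective, [V 0] is
    trivial, so the Gram-Schmidt process builds, degree after degree, linear
    orthogonal projectors [P n] onto [V n] ([orthogonal_projector_extend]).

    These projectors are the scheme.  They are contractions, hence continuous
    ([orthogonal_projector_continuous]), and [P n f] is the best approximation
    of [f] in [V n] ([orthogonal_projector_best]).  So an element [h] of [V N]
    close to [f], provided by density, forces every [P n f] with [N <= n] to
    be at least as close to [f]. *)

(** * Orthogonal projectors in Hilbert spaces *)

Section OrthogonalProjectors.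
Set Implicit Arguments.
Unset Strict Implicit.
Import Order.TTheory GRing.Theory Num.Theory.
Import numFieldNormedType.Exports.
Local Open Scope classical_set_scope.
Local Open Scope ring_scope.
Variables (K : numClosedFieldType) (H : hilbertType K).
Implicit Types (V W : {pred H}) (P : {linear H -> H}).

Lemma inner_eq0C (u v : H) : inner u v = 0 -> inner v u = 0.
Proof. by move=> uv0; rewrite hermC/= uv0 rmorph0 mulr0. Qed.

Lemma ler_norm_orthogonalDl (u v : H) : inner u v = 0 -> `|u| <= `|u + v|.
Proof.
move=> uv0; rewrite -(@ler_pXn2r _ 2) ?nnegrE ?normr_ge0//.
by rewrite !sqr_normE hnormDd//= lerDl -sqr_normE exprn_ge0.
Qed.

Definition orthogonal_projector V P :=
  forall x, P x \in V /\ {in V, forall v, inner (x - P x) v = 0}.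

(** Pythagoras: [x - v] is the sum of [x - P x] and of [P x - v], an element
    of [V]. *)
Lemma orthogonal_projector_best V P : submod_closed V ->
  orthogonal_projector V P ->
  forall x v, v \in V -> `|x - P x| <= `|x - v|.
Proof.
move=> [_ linV] VP x v Vv; have [VPx ortho] := VP x.
rewrite -(subrKA (P x) x (- v)); apply/ler_norm_orthogonalDl/ortho.
by rewrite addrC -scaleN1r linV.
Qed.

(** Pythagoras again, for [x = P x + (x - P x)]: a projector is a contraction. *)
Lemma orthogonal_projector_continuous V P :
  orthogonal_projector V P -> continuous P.
Proof.
move=> VP; apply/linear_bounded_continuous/linear_boundedP.
near=> r => x; have [VPx ortho] := VP x.
apply: (@le_trans _ _ `|x|); last first.
  by rewrite -[leLHS]mul1r ler_wpM2r//; near: r; exact: nbhs_pinfty_ge.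
by rewrite -[X in _ <= `|X|](subrKC (P x)); apply/ler_norm_orthogonalDl/inner_eq0C/ortho.
Unshelve. all: by end_near. Qed.

(** One step of the Gram-Schmidt process: [P] gains the rank one projector
    onto the line spanned by [e], the component of [g] orthogonal to [V]. *)
Lemma orthogonal_projector_extend V W P (g : H) : submod_closed V ->
  (forall w, w \in W <-> exists a, exists2 v, v \in V & w = a *: g + v) ->
  orthogonal_projector V P -> exists Q, orthogonal_projector W Q.
Proof.
move=> [_ linV] WE VP.
pose e := g - P g; pose c (x : H) := inner x e / inner e e.
pose q (x : H) := c x *: e + P x.
have linq : linear q.
  move=> a x y; rewrite /q /c linearPl/= linearP mulrDl scalerDl -mulrA.
  by rewrite addrACA -scalerA -(scalerDr a).
pose Q : {linear H -> H} := HB.pack q (GRing.isLinear.Build K H H *:%R q linq).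
exists Q => x; rewrite -[Q x]/(c x *: e + P x).
have [VPx orthox] := VP x; have [VPg orthoe] := VP g.
split.
  apply/WE; exists (c x); exists (- c x *: P g + P x); first exact: linV.
  by rewrite scalerBr scaleNr addrA.
have orthoV v : v \in V -> inner (x - (c x *: e + P x)) v = 0.
  move=> Vv; rewrite addrC opprD -addrA (addrC _ x) addrC.
  by rewrite linearBl/= linearZl_LR/= orthox// orthoe// mulr0 subr0.
(* If [g] already lies in [V], then [e = 0] and [c] divides by [0], but the
     claim is about an inner product with [0]. *)
have orthoE : inner (x - (c x *: e + P x)) e = 0.
  have Pxe : inner (P x) e = 0 by exact/inner_eq0C/orthoe.
  rewrite linearBl/= linearDl/= linearZl_LR/= Pxe addr0 /c.
  have [->|e0] := eqVneq e 0; first by rewrite !linear0r subr0.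
  by rewrite divfK ?subrr// -sqr_normE sqrf_eq0 normr_eq0.
move=> _ /WE[a [v Vv ->]].
have -> : g = e + P g by rewrite subrK.
by rewrite (scalerDr a) -addrA linearDr/= linearZr_LR/= orthoE mulr0 add0r orthoV// linV.
Qed.

(** Since [P n x] is the best approximation of [x] in [V n], a single element
    of some [V N] close to [x] controls all the later projections of [x]. *)
Lemma orthogonal_projectors_cvg (V : nat -> {pred H})
    (P : nat -> {linear H -> H}) :
  (forall n, submod_closed (V n)) ->
  (forall m n, (m <= n)%N -> {subset V m <= V n}) ->
  (forall n, orthogonal_projector (V n) (P n)) ->
  dense [set x | exists n, x \in V n] ->
  forall x : H, `|P n x - x| @[n --> \oo] --> (0 : K).
Proof.
move=> subV homoV VP denseV x; apply/cvgrPdist_lt => eps eps0.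
have [|h [xh [N VNh]]] := denseV _ _ (@ball_open K H x eps).
  by exists x; exact: ballxx.
near=> n; rewrite sub0r normrN normr_id distrC.
move: xh; rewrite -ball_normE/=; apply: le_lt_trans.
apply: (orthogonal_projector_best (subV n) (VP n)).
by apply: homoV VNh; near: n; exact: nbhs_infty_ge.
Unshelve. all: by end_near. Qed.

Lemma dense_of_approximation (D : set H) (T : nat -> H -> H) :
  (forall n x, D (T n x)) ->
  (forall x, `|T n x - x| @[n --> \oo] --> (0 : K)) -> dense D.
Proof.
move=> DT cvgT O [x Ox] openO.
have /nbhs_ballP[eps eps0 epsO] : nbhs x O by exact: open_nbhs_nbhs.
have [n _ /(_ n (leqnn n))] := (cvgrPdist_lt _ _).1 (cvgT x) _ eps0.
rewrite /= sub0r normrN normr_id distrC => xTn.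
by exists (T n x); split; [apply: epsO; rewrite -ball_normE | exact: DT].
Qed.

End OrthogonalProjectors.

(** * The degree filtration of the polynomials in a space of functions *)

Section DegreeFiltration.
Set Implicit Arguments.
Unset Strict Implicit.
Import Order.TTheory GRing.Theory Num.Theory.
Local Open Scope classical_set_scope.
Local Open Scope ring_scope.
Variables (R : realType) (H : hilbertType (cplx R)) (incl : {linear H -> Hol R}).
Local Notation C := (cplx R).

Definition degree_filtration (n : nat) : {pred H} :=
  fun f => `[< exists2 p : {poly C},
    (size p <= n)%N & forall z : @disk R, incl f z = p.[val z] >].

Lemma incl_linear (a : C) (f g : H) (z : @disk R) :
  incl (a *: f + g) z = a * incl f z + incl g z.
Proof. by rewrite linearP. Qed.

Lemma degree_filtration_submod_closed n : submod_closed (degree_filtration n).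
Proof.
split.
  apply/asboolP; exists 0 => [|z]; first by rewrite size_poly0.
  by rewrite linear0 horner0.
move=> a f g /asboolP[p pn fp] /asboolP[q qn gq]; apply/asboolP.
exists (a *: p + q) => [|z].
  by rewrite (leq_trans (size_polyD _ _))// geq_max qn (leq_trans (size_scale_leq _ _)).
by rewrite incl_linear fp gq hornerD hornerZ.
Qed.

Lemma degree_filtration_homo m n : (m <= n)%N ->
  {subset degree_filtration m <= degree_filtration n}.
Proof.
move=> mn f /asboolP[p pm fp]; apply/asboolP.
by exists p => //; exact: leq_trans mn.
Qed.

Lemma degree_filtration0 f : injective incl ->
  (f \in degree_filtration 0) = (f == 0).
Proof.
move=> incl_inj; apply/asboolP/eqP => [[p]|->]; last first.
  by exists 0 => [|z]; rewrite ?size_poly0// linear0 horner0.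
rewrite leqn0 size_poly_eq0 => /eqP-> f0; apply/incl_inj/val_inj/funext => z.
by rewrite linear0 [LHS]f0 horner0.
Qed.

(** Take for [g] any element outside the smaller space, or [0] if there is
    none: in the former case the coefficient of degree [n] of [g] is nonzero,
    and a multiple of [g] cancels that of [f]. *)
Lemma degree_filtrationS n : exists g, forall f,
  f \in degree_filtration n.+1 <->
  exists a, exists2 h, h \in degree_filtration n & f = a *: g + h.
Proof.
have homo := @degree_filtration_homo n n.+1 (leqnSn n).
have [_ linS] := degree_filtration_submod_closed n.+1.
have [le|] := pselect {subset degree_filtration n.+1 <= degree_filtration n}.
  exists 0 => f; split=> [/le fn|[a [h /homo hn ->]]].
    by exists 0, f; rewrite // scaler0 add0r.
  by rewrite scaler0 add0r.
move=> /existsNP[g /not_implyP[gS /negP gn]].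
exists g => f; split=> [|[a [h /homo hn ->]]]; last exact: linS.
have /asboolP[q qS gq] := gS; move=> /asboolP[p pS fp].
have qn0 : q`_n != 0.
  apply: contra gn => /eqP qn0; apply/asboolP; exists q => //.
  apply/leq_sizeP => j; rewrite leq_eqVlt => /predU1P[<-//|].
  exact/leq_sizeP.
pose a := p`_n / q`_n; exists a, (- a *: g + f).
  apply/asboolP; exists (- a *: q + p) => [|z].
    apply/leq_sizeP => j; rewrite leq_eqVlt => /predU1P[<-|nj].
      by rewrite coefD coefZ mulNr divfK// addNr.
    by rewrite coefD coefZ (leq_sizeP _ _ qS)// (leq_sizeP _ _ pS)// mulr0 addr0.
  by rewrite incl_linear fp gq hornerD hornerZ.
by rewrite scaleNr addNKr.
Qed.

Lemma polynomials_inE :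
  polynomials_in incl = [set f | exists n, f \in degree_filtration n].
Proof.
apply/seteqP; split=> [f [p fp]|f [n /asboolP[p _ fp]]]; last by exists p.
by exists (size p); apply/asboolP; exists p.
Qed.

Lemma degree_projector_ex : injective incl ->
  forall n, exists P, orthogonal_projector (degree_filtration n) P.
Proof.
move=> incl_inj; elim=> [|n [P VP]].
  exists \0 => x; split; first by rewrite degree_filtration0.
  by move=> v; rewrite degree_filtration0// => /eqP->; rewrite linear0r.
have [g gE] := degree_filtrationS n.
exact: orthogonal_projector_extend (degree_filtration_submod_closed n) gE VP.
Qed.

End DegreeFiltration.

Theorem corollary1p2 (R : realType) (H : hilbertType (cplx R))
    (incl : {linear H -> Hol R}%R) :
  hilbert_holomorphic_space incl ->
  ((exists T : nat -> {linear H -> H}%R,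
      linear_polynomial_approximation_scheme incl T) <->
   dense (polynomials_in incl)).
Proof.
move=> [incl_inj _]; split=> [[T [_ TP]]|densepoly].
  apply: (@dense_of_approximation _ _ _ T) => [n f|f].
    exact: (TP f).1.
  exact: (TP f).2.
have [P VP] := choice (degree_projector_ex incl_inj).
exists P; split=> [n|f]; first exact: orthogonal_projector_continuous (VP n).
split=> [n|].
  have [/asboolP[p _ Pp] _] := VP n f; by exists p.
move: densepoly; rewrite polynomials_inE.
move/(orthogonal_projectors_cvg (degree_filtration_submod_closed incl)).
by apply; [exact: degree_filtration_homo | exact: VP].
Qed.
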